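(* Let $n\geq 1$. The monoid $\mathcal{IO}_n$ is defined by the monoid presentation $\langle A\cup B\mid R\rangle$, where $A\cup B=\{a_1,\ldots,a_{n-1},b_1,\ldots,b_{n-1}\}$ is an alphabet with $2n-2$ letters and $R$ is the following set of $\frac{1}{2}(3n^2-n-2)$ relations on $(A\cup B)^*$: $(R_1)$ $a_ia_{n-1}=a_i$, for $1\leq i\leq n-1$; $(R_2)$ $a_ia_j=a_{j+1}a_i$, for $1\leq i\leq j\leq n-2$; $(R_3)$ $b_ib_1=b_i$, for $1\leq i\leq n-1$; $(R_4)$ $b_ib_{j+1}=b_{j+1}b_{i+1}$, for $1\leq i\leq j\leq n-2$; $(R_5)$ $b_ia_j=a_jb_i$, for $1\leq i<j\leq n-1$; $(R_6)$ $b_ia_1=a_i$, for $1\leq i\leq n-1$; $(R_7)$ $a_ib_{n-1}=b_i$, for $1\leq i\leq n-1$.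
   Context: Let $\Omega_n=\{1,\ldots,n\}$ with the usual linear order. Transformations of $\Omega_n$ are written on the right of their arguments and composed from left to right: $x(\alpha\beta)=(x\alpha)\beta$. $\mathcal{IO}_n$ is the monoid, under composition, of all full transformations $\alpha:\Omega_n\to\Omega_n$ that are order-preserving ($x\leq y$ implies $x\alpha\leq y\alpha$) and whose image is an interval of $\Omega_n$ (if $x\leq y\leq z$ and $x,z\in\mathrm{Im}(\alpha)$ then $y\in\mathrm{Im}(\alpha)$). A monoid presentation $\langle C\mid S\rangle$ consists of an alphabet $C$ and a set $S\subseteq C^*\times C^*$ of relations on the free monoid $C^*$, a pair $(u,v)$ being written $u=v$; $\sim_S$ denotes the smallest congruence on $C^*$ containing $S$. A monoid $M$ is defined by the presentation $\langle C\mid S\rangle$ if $M$ is isomorphic to $C^*/\sim_S$. (In this result the letter $a_i$ represents the transformation of $\Omega_n$ with $xa_i=x$ for $x\leq i$ and $xa_i=x-1$ for $x\geq i+1$, and the letter $b_i$ represents the transformation with $xb_i=x+1$ for $x\leq i$ and $xb_i=x$ for $x\geq i+1$. For $n=1$ the alphabet and the set of relations are empty.) *)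

(* Defs.v *)
From HB Require Import structures.
From mathcomp Require Import all_boot.
From mathcomp Require Import boolp classical_sets functions cardinality.
From mathcomp Require Import zify.

Set Implicit Arguments.
Unset Strict Implicit.
Unset Printing Implicit Defensive.

(* Throughout, the points 1, ..., n of Omega_n are the elements 0, ..., n - 1 of
   'I_n, and the indices 1, ..., n - 1 of the letters a_i, b_i are the elements
   0, ..., n - 2 of 'I_n.-1; so every point and every index is shifted by one. *)

Section IO.
Variable n : nat.
Implicit Types f g : {ffun 'I_n -> 'I_n}.

Definition order_preserving f : bool :=
  [forall x : 'I_n, forall y : 'I_n, (x <= y) ==> (f x <= f y)].

Definition interval_image f : bool :=
  [forall x : 'I_n, forall y : 'I_n, forall z : 'I_n,
    [&& x <= y, y <= z, x \in codom f & z \in codom f] ==> (y \in codom f)].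

Record IO := MkIO {
  IO_fun :> {ffun 'I_n -> 'I_n};
  IO_funP : order_preserving IO_fun && interval_image IO_fun }.

HB.instance Definition _ := [isSub for IO_fun].
HB.instance Definition _ := [Finite of IO by <:].

Lemma order_preservingP f :
  reflect (forall x y : 'I_n, x <= y -> f x <= f y) (order_preserving f).
Proof.
apply: (iffP forallP) => [h x y|h x].
  by move/forallP: (h x) => /(_ y) /implyP.
by apply/forallP => y; apply/implyP; apply: h.
Qed.

Lemma interval_imageP f :
  reflect (forall x y z : 'I_n, x <= y -> y <= z ->
             x \in codom f -> z \in codom f -> y \in codom f)
          (interval_image f).
Proof.
apply: (iffP forallP) => [h x y z xy yz xf zf|h x].
  move/forallP: (h x) => /(_ y)/forallP/(_ z)/implyP; apply.
  by rewrite xy yz xf.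
apply/forallP => y; apply/forallP => z; apply/implyP => /and4P[].
exact: h.
Qed.

Lemma IO_one_subproof :
  let f := [ffun x : 'I_n => x] in order_preserving f && interval_image f.
Proof.
apply/andP; split.
  by apply/order_preservingP => x y; rewrite !ffunE.
by apply/interval_imageP => x y z *; apply/codomP; exists y; rewrite ffunE.
Qed.

Definition IO_one : IO := MkIO IO_one_subproof.

Lemma IO_mul_subproof (f g : IO) :
  let h := [ffun x : 'I_n => g (f x)] in order_preserving h && interval_image h.
Proof.
have /andP[/order_preservingP fo /interval_imageP fi] := IO_funP f.
have /andP[/order_preservingP go /interval_imageP gi] := IO_funP g.
rewrite /=; apply/andP; split.
  by apply/order_preservingP => x y xy; rewrite !ffunE; apply/go/fo.
apply/interval_imageP => x y z xy yz /codomP[x' ex] /codomP[z' ez].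
rewrite !ffunE in ex ez.
have /codomP[w ew] : y \in codom g.
  by apply: (gi x y z) => //; rewrite ?ex ?ez codom_f.
case: (leqP w (f x')) => [wx|xw].
  suff -> : y = x.
    by rewrite ex; apply/codomP; exists x'; rewrite ffunE.
  by apply: val_inj; apply/eqP; rewrite eqn_leq xy ew ex (go _ _ wx).
case: (leqP (f z') w) => [zw|wz].
  suff -> : y = z.
    by rewrite ez; apply/codomP; exists z'; rewrite ffunE.
  by apply: val_inj; apply/eqP; rewrite eqn_leq yz ew ez (go _ _ zw).
have /codomP[t et] : w \in codom f.
  by apply: (fi (f x') w (f z')); rewrite ?codom_f // ltnW.
by apply/codomP; exists t; rewrite ffunE -et.
Qed.

(* Maps act on the right of their arguments: x (f g) = (x f) g. *)
Definition IO_mul (f g : IO) : IO := MkIO (IO_mul_subproof f g).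

Lemma IO_mulA : associative IO_mul.
Proof. by move=> f g h; apply/val_inj/ffunP => x; rewrite !ffunE. Qed.

Lemma IO_mul1 : left_id IO_one IO_mul.
Proof. by move=> f; apply/val_inj/ffunP => x; rewrite !ffunE. Qed.

Lemma IO_mulr1 : right_id IO_one IO_mul.
Proof. by move=> f; apply/val_inj/ffunP => x; rewrite !ffunE. Qed.

HB.instance Definition _ := isMonoid.Build IO IO_mulA IO_mul1 IO_mulr1.

Lemma a_fun_subproof (i : 'I_n.-1) (x : 'I_n) :
  (if x <= i then x : nat else x.-1) < n.
Proof.
case: ifP => _ //.
exact: leq_ltn_trans (leq_pred x) (ltn_ord x).
Qed.

Lemma b_fun_subproof (i : 'I_n.-1) (x : 'I_n) :
  (if x <= i then x.+1 else x : nat) < n.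
Proof.
by case: ifP => // xi; have := ltn_ord i; lia.
Qed.

Definition a_fun (i : 'I_n.-1) : {ffun 'I_n -> 'I_n} :=
  [ffun x => Ordinal (a_fun_subproof i x)].

Definition b_fun (i : 'I_n.-1) : {ffun 'I_n -> 'I_n} :=
  [ffun x => Ordinal (b_fun_subproof i x)].

Lemma a_fun_IO i : order_preserving (a_fun i) && interval_image (a_fun i).
Proof.
have aE x : a_fun i x = (if x <= i then x : nat else x.-1) :> nat by rewrite ffunE.
apply/andP; split.
  apply/order_preservingP => x y xy; rewrite !aE.
  case: (leqP x i) => xi; case: (leqP y i) => yi //; lia.
apply/interval_imageP => x y z xy yz /codomP[x' ex] /codomP[z' ez].
apply/codomP; case: (leqP y i) => [yi|iy].
  by exists y; apply: ord_inj; rewrite aE yi.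
have hy : y.+1 < n.
  move: (aE z') (ltn_ord z'); rewrite -ez; case: (leqP z' i) => zi; lia.
exists (Ordinal hy); apply: ord_inj; rewrite aE /=.
by case: (leqP y.+1 i) => // yi; lia.
Qed.

Lemma b_fun_IO i : order_preserving (b_fun i) && interval_image (b_fun i).
Proof.
have bE x : b_fun i x = (if x <= i then x.+1 else x : nat) :> nat by rewrite ffunE.
apply/andP; split.
  apply/order_preservingP => x y xy; rewrite !bE.
  case: (leqP x i) => xi; case: (leqP y i) => yi //; lia.
apply/interval_imageP => x y z xy yz /codomP[x' ex] /codomP[z' ez].
apply/codomP; case: (leqP y i) => [yi|iy].
  have y0 : 0 < y.
    by move: (bE x'); rewrite -ex; case: (leqP x' i) => zi; lia.
  have hy : y.-1 < n by have := ltn_ord y; lia.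
  exists (Ordinal hy); apply: ord_inj; rewrite bE /=.
  by case: (leqP y.-1 i) => yi'; lia.
by exists y; apply: ord_inj; rewrite bE leqNgt iy.
Qed.

Definition a_IO (i : 'I_n.-1) : IO := MkIO (a_fun_IO i).
Definition b_IO (i : 'I_n.-1) : IO := MkIO (b_fun_IO i).

End IO.

Section Presentation.
Variable C : choiceType.

(* The free monoid C^* is seq C under concatenation. *)
Implicit Types (u v w : seq C) (S : set (seq C * seq C)).

Inductive word_congr S : seq C -> seq C -> Prop :=
| word_congr_rel u v : S (u, v) -> word_congr S u v
| word_congr_refl u : word_congr S u u
| word_congr_sym u v : word_congr S u v -> word_congr S v u
| word_congr_trans u v w : word_congr S u v -> word_congr S v w -> word_congr S u w
| word_congr_cat u u' v v' :
    word_congr S u u' -> word_congr S v v' -> word_congr S (u ++ v) (u' ++ v').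

Definition word_congrb S u v : bool := `[< word_congr S u v >].

Lemma word_congrb_equiv S : equiv_class_of (word_congrb S).
Proof.
split=> [u|u v|v u w /asboolP uv /asboolP vw].
- exact/asboolP/word_congr_refl.
- by apply/asboolP/asboolP => /word_congr_sym.
- exact/asboolP/(word_congr_trans uv).
Qed.

Canonical word_congrb_equiv_rel S : equiv_rel (seq C) := EquivRelPack (word_congrb_equiv S).

(* The quotient C^* / ~_S. *)
Definition presented S : Type := {eq_quot word_congrb_equiv_rel S}%qT.

Section Quotient.
Variable S : set (seq C * seq C).

HB.instance Definition _ := Choice.on (presented S).
HB.instance Definition _ :=
  EqQuotient.copy (presented S) {eq_quot word_congrb_equiv_rel S}%qT.

Definition class_of (u : seq C) : presented S := (\pi u)%qT.

Definition presented_mul (x y : presented S) : presented S :=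
  class_of (repr x ++ repr y).

Lemma class_ofP u v : class_of u = class_of v <-> word_congr S u v.
Proof.
rewrite /class_of; split=> [/eqmodP/asboolP//|uv].
exact/eqmodP/asboolP.
Qed.

Lemma class_ofK x : class_of (repr x) = x.
Proof. exact: reprK. Qed.

Lemma class_of_cat u v : class_of (u ++ v) = presented_mul (class_of u) (class_of v).
Proof. by apply/class_ofP/word_congr_cat; apply/class_ofP; rewrite class_ofK. Qed.

Lemma presented_mulA : associative presented_mul.
Proof.
move=> x y z; rewrite -[x]class_ofK -[y]class_ofK -[z]class_ofK.
by rewrite -!class_of_cat catA.
Qed.

Lemma presented_mul1 : left_id (class_of [::]) presented_mul.
Proof. by move=> x; rewrite -[x]class_ofK -class_of_cat. Qed.

Lemma presented_mulr1 : right_id (class_of [::]) presented_mul.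
Proof. by move=> x; rewrite -[x]class_ofK -class_of_cat cats0. Qed.

HB.instance Definition _ :=
  isMonoid.Build (presented S) presented_mulA presented_mul1 presented_mulr1.

End Quotient.
End Presentation.

(* The alphabet A u B, a disjoint union. *)
Definition letter (n : nat) : Type := ('I_n.-1 + 'I_n.-1)%type.
HB.instance Definition _ n := Finite.on (letter n).

Definition a_ n (i : 'I_n.-1) : letter n := inl i.
Definition b_ n (i : 'I_n.-1) : letter n := inr i.

(* A side condition such as k.+1 = n.-1 says that k stands for the index n - 1,
   k = 0 that it stands for the index 1; the existence of j' : 'I_n.-1 with
   j' = j.+1 is the bound j <= n - 2. *)
Inductive IO_rel (n : nat) : seq (letter n) * seq (letter n) -> Prop :=
| R1 (i k : 'I_n.-1) : k.+1 = n.-1 ->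
    IO_rel ([:: a_ i; a_ k], [:: a_ i])
| R2 (i j j' : 'I_n.-1) : i <= j -> j' = j.+1 :> nat ->
    IO_rel ([:: a_ i; a_ j], [:: a_ j'; a_ i])
| R3 (i k : 'I_n.-1) : k = 0 :> nat ->
    IO_rel ([:: b_ i; b_ k], [:: b_ i])
| R4 (i j i' j' : 'I_n.-1) : i <= j -> i' = i.+1 :> nat -> j' = j.+1 :> nat ->
    IO_rel ([:: b_ i; b_ j'], [:: b_ j'; b_ i'])
| R5 (i j : 'I_n.-1) : i < j ->
    IO_rel ([:: b_ i; a_ j], [:: a_ j; b_ i])
| R6 (i k : 'I_n.-1) : k = 0 :> nat ->
    IO_rel ([:: b_ i; a_ k], [:: a_ i])
| R7 (i k : 'I_n.-1) : k.+1 = n.-1 ->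
    IO_rel ([:: a_ i; b_ k], [:: b_ i]).

Definition IO_rels (n : nat) : set (seq (letter n) * seq (letter n)) := @IO_rel n.
Arguments IO_rels n : clear implicits.

(* Main.v *)
(* Let a_D be the product of the letters a_d for d in a set D, in decreasing order
   of d.  Every word is equivalent to some a_D b_{n-1}^s with s <= |D|: as
   b_i = a_i b_{n-1} by R7, it suffices to multiply such words on the left by a_i,
   which R2 inserts into a_D (R1 absorbs a letter that would get the index n), and
   by b_{n-1}, which moves across a_D by b_{n-1} a_j = a_{n-1} a_{j-1} b_{n-1} for
   j > 1 and disappears at b_{n-1} a_1 = a_{n-1}.  This word represents the map
   x |-> x - |{d in D | d < x}| + s.  A map f in IO_n grows by 0 or 1 at each step
   because its image is an interval, so it arises in this way from exactly one
   pair, namely D = {i | i f = (i + 1) f} and s = 1 f - 1. *)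

Require Import Defs.
From HB Require Import structures.
From mathcomp Require Import all_boot.
From mathcomp Require Import boolp classical_sets functions cardinality.
From mathcomp Require Import zify.

Set Implicit Arguments.
Unset Strict Implicit.
Unset Printing Implicit Defensive.

(** * Normal-form products in a monoid *)

Section NormalForm.
Variables (M : monoidType) (I : Type) (a : I -> M) (b : M).
Local Open Scope group_scope.

Definition nf (D : seq I) (s : nat) : M := foldr (fun d x => a d * x) (b ^+ s) D.

Lemma nf_cons d D s : nf (d :: D) s = a d * nf D s.
Proof. by []. Qed.

End NormalForm.

Lemma nf_morph (M N : monoidType) (f : UMagmaMorphism.type M N) (I : Type)
    (a : I -> M) (b : M) D s :
  f (nf a b D s) = nf (f \o a) (f b) D s.
Proof.
elim: D => [|d D IH] /=; last by rewrite gmulfM IH.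
elim: s => [|s IH]; first by rewrite !expg0 gmulf1.
by rewrite !expgS gmulfM IH.
Qed.

(** * Reduction to normal form by means of the relations *)

Definition gt_sorted k (D : seq 'I_k) := sorted gtn [seq val d | d <- D].

(* With [n = k.+2], [ord_max] stands for the index n - 1 and [ord0] for the index 1. *)
Section Reduction.
Local Open Scope group_scope.
Variables (k : nat) (M : monoidType) (a b : 'I_k.+1 -> M).
Implicit Types D : seq 'I_k.+1.
Notation be := (b ord_max).
Hypothesis a_max : forall i, a i * a ord_max = a i.
Hypothesis a_swap : forall i j j' : 'I_k.+1, i <= j -> j' = j.+1 :> nat ->
  a i * a j = a j' * a i.
Hypothesis b_swap : forall i j i' j' : 'I_k.+1, i <= j -> i' = i.+1 :> nat ->
  j' = j.+1 :> nat -> b i * b j' = b j' * b i'.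
Hypothesis b_a : forall i j : 'I_k.+1, i < j -> b i * a j = a j * b i.
Hypothesis b_a0 : forall i, b i * a ord0 = a i.
Hypothesis a_bmax : forall i, a i * be = b i.

(** Writing [a j] as [b j * a ord0] lets R4 act: [be * b j] becomes [b i * be]. Then [be * a ord0]
    collapses to [a ord_max] by R6, which commutes with [b i] by R5, and R7 expands [b i]. *)
Lemma bmax_a (i j : 'I_k.+1) : j = i.+1 :> nat ->
  be * a j = a ord_max * (a i * be).
Proof.
move=> ji; have ik : i < k by have := ltn_ord j; lia.
rewrite -(b_a0 j) mulgA -(@b_swap i (inord k.-1)) ?inordK //=; try lia.
by rewrite -mulgA b_a0 b_a // a_bmax.
Qed.

Notation nf := (nf a be).

(** Insertion with carry: R2 moves [a i] to the right past each [a d] with [i <= d], raising [d] by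
    one, until a smaller index or the end is met. The bound [c <= k] keeps the raised [d] an
    index. *)
Lemma a_nf_path c (i : 'I_k.+1) D s : c <= k -> i <= c ->
  path gtn c [seq val d | d <- D] ->
  exists D', [/\ path gtn c.+1 [seq val d | d <- D'], size D' = (size D).+1
               & a i * nf D s = nf D' s].
Proof.
elim: D c => [|d D IH] c ck ic /=; first by exists [:: i]; rewrite /= ltnS ic.
move=> /andP[dc dD]; case: (ltnP d i) => di.
  by exists (i :: d :: D); rewrite /= ltnS ic di.
have dk : d.+1 < k.+1 by rewrite ltnS (leq_trans dc).
have [|D' [pD' sD' eD']] := IH d _ di dD; first exact: ltnW.
exists (Ordinal dk :: D'); split; rewrite /= ?sD' // -?eD'.
  by rewrite ltnS dc.
by rewrite mulgA (@a_swap i d (Ordinal dk)) // mulgA.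
Qed.

Definition reduced x :=
  exists D s, [/\ gt_sorted D, s <= size D & x = nf D s].

Lemma reduced_a i x : reduced x -> reduced (a i * x).
Proof.
move=> [D [s [+ + ->]]].
have insert E : path gtn k [seq val d | d <- E] -> exists E',
    [/\ gt_sorted E', size E' = (size E).+1 & a i * nf E s = nf E' s].
  have ik : i <= k by rewrite -ltnS.
  by move=> /(a_nf_path s (leqnn k) ik)[E' [/path_sorted]]; exists E'.
case: D => [|d D] sD ss.
  by exists [:: i], s; split=> //; apply: leq_trans ss _.
(* A head with the last index cannot be raised. R1 absorbs it into [a i], which is then inserted
   into the tail, so the length stays the same. *)
case: (ltnP d k) => dk.
  have [|D' [sD' szD' eD']] := insert (d :: D); first by rewrite /= dk.
  by exists D', s; rewrite eD' szD' leqW.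
have {dk} dk : d = k :> nat by apply/eqP; rewrite eqn_leq dk -ltnS ltn_ord.
have -> : d = ord_max by apply: val_inj.
have [|D' [sD' szD' eD']] := insert D; first by move: sD; rewrite /gt_sorted /= dk.
by exists D', s; rewrite /= mulgA a_max eD' szD'.
Qed.

(** Each index drops by one as [be] passes it. The factor [a ord_max] left by one letter is absorbed
    by the letter before it (R1); if [be] reaches the end, R7 supplies this factor. The inequality
    says that exponent minus length does not grow when [a ord_max] is counted, so it passes through
    the induction and preserves [s <= size D]. *)
Lemma bmax_nf_path c D s : path gtn c [seq val d | d <- D] ->
  exists D' s', [/\ path gtn c.-1 [seq val d | d <- D'],
    s' + size D <= s + (size D').+1 & be * nf D s = a ord_max * nf D' s'].
Proof.
elim: D c => [|d D IH] c /=.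
  by exists [::], s.+1; rewrite /= addn0 addn1 expgS mulgA a_bmax.
move=> /andP[dc dD]; have [d0|d0] := posnP d.
  have D0 : D = [::] by case: (D) dD => //= e ? /andP[]; rewrite d0.
  exists [::], s; rewrite D0 mulgA; split=> //=.
  by have -> : d = ord0 by [apply: val_inj]; rewrite b_a0.
have [D' [s' [pD' sD' eD']]] := IH _ dD.
have dk : d.-1 < k.+1 by rewrite (leq_ltn_trans (leq_pred _)).
exists (Ordinal dk :: D'), s'; split; first by rewrite /= pD' andbT; lia.
  by rewrite /= addnS [in leqRHS]addnS ltnS.
rewrite mulgA (@bmax_a (Ordinal dk)) ?prednK //=.
by rewrite -!mulgA eD' [a (Ordinal dk) * (_ * _)]mulgA a_max.
Qed.

Lemma reduced_bmax x : reduced x -> reduced (be * x).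
Proof.
move=> [D [s [sD ss ->]]].
(* The bound [k.+1] exceeds every index, so all of [D'] lies below [ord_max], which may be put in
   front. *)
have [|D' [s' [pD' sD' eD']]] := @bmax_nf_path k.+1 D s.
  by rewrite path_min_sorted //; apply/allP => _ /mapP[d _ ->] /=.
by exists (ord_max :: D'), s'; rewrite eD' /=; split=> //=; lia.
Qed.

Lemma reduced_b i x : reduced x -> reduced (b i * x).
Proof. by rewrite -a_bmax -mulgA => rx; apply/reduced_a/reduced_bmax. Qed.

Lemma reduced1 : reduced 1.
Proof. by exists [::], 0. Qed.

End Reduction.

(** * Maps of normal forms and normal forms of maps *)

Section Values.
Variable k : nat.
Local Notation I := 'I_k.+1.
Local Notation X := 'I_k.+2.
Implicit Types (D : seq I) (f : IO k.+2).

Definition count_lt (x : nat) D := count (fun d : I => d < x) D.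

Lemma count_ltS (i : I) D : uniq D -> count_lt i.+1 D = count_lt i D + (i \in D).
Proof.
elim: D => [|d D IH] //= /andP[dD uD]; rewrite IH // in_cons ltnS leq_eqVlt eq_sym.
rewrite -(inj_eq val_inj) /=; case: eqP => [/val_inj->|_] /=; last lia.
by rewrite (negPf dD); lia.
Qed.

Lemma count_lt_size D : count_lt k.+1 D = size D.
Proof. by rewrite -[RHS]count_predT; apply: eq_count => d /=; rewrite ltn_ord. Qed.

Lemma count_lt_leq x D : uniq D -> x <= k.+1 -> count_lt x D <= x.
Proof.
move=> uD; elim: x => [|x IH] xk; first by rewrite leqn0 /count_lt count_pred0.
have := count_ltS (Ordinal xk) uD; rewrite /= => ->.
by have := IH (ltnW xk); case: (_ \in _) => /=; lia.
Qed.

(** Only [y] indices are at least [x]. Hence [x - count_lt x D + s] never exceeds the last point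
    when [s <= size D]. *)
Lemma size_count_lt x y D : uniq D -> x + y = k.+1 -> size D <= count_lt x D + y.
Proof.
move=> uD; elim: y x => [|y IH] x; rewrite ?addn0 => xy.
  by rewrite xy count_lt_size.
have xk : x < k.+1 by lia.
have := IH x.+1; rewrite (count_ltS (Ordinal xk) uD) /=.
by case: (_ \in _) => /=; lia.
Qed.

Lemma gt_sorted_uniq D : gt_sorted D -> uniq D.
Proof.
move=> sD; rewrite -(map_inj_uniq val_inj).
by apply: sorted_uniq sD => [x y z|x] /=; [move=> yx xz; apply: ltn_trans yx | rewrite ltnn].
Qed.

Notation nfIO := (nf (@a_IO k.+2) (b_IO (ord_max : 'I_(k.+2).-1))).

Lemma exp_b_max s (x : X) : (nfIO [::] s) x = minn (x + s) k.+1 :> nat.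
Proof.
rewrite /=; elim: s x => [|t IH] x; first by rewrite ffunE; have := ltn_ord x; lia.
by rewrite expgS ffunE IH ffunE /=; have := ltn_ord x; case: (leqP x k); lia.
Qed.

Lemma nf_val D s (x : X) : gt_sorted D -> s <= size D ->
  nfIO D s x = x - count_lt x D + s :> nat.
Proof.
move=> sD ss; have uD := gt_sorted_uniq sD.
have xk : x <= k.+1 by rewrite -ltnS.
(* The induction needs the truncated formula, since [s <= size D] is lost on passing to a tail of
   [D]. For the full [D] the truncation has no effect. *)
have -> : (x - count_lt x D + s)%N = minn (x - count_lt x D + s) k.+1.
  by have := count_lt_leq uD xk; have := size_count_lt uD (subnKC xk); lia.
elim: D sD x {ss uD xk} => [|d D IH] sD x.
  by rewrite exp_b_max subn0.
rewrite nf_cons ffunE IH; last exact: path_sorted sD.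
rewrite [a_IO _ _]ffunE /=.
have Dd e : e \in D -> e < d.
  move=> eD; move: sD => /order_path_min /allP; apply; last exact: map_f.
  by move=> u v w uv wu; apply: ltn_trans wu uv.
case: (leqP x d) => xd; first by [].
(* Here [a_d] lowers [x] to [x.-1 >= d], which is still above every entry of [D]. *)
have -> : count_lt x.-1 D = count_lt x D.
  by apply: eq_in_count => e /Dd /=; lia.
by congr minn; lia.
Qed.

(** [widen_ord] and [lift ord0] turn an index into the two consecutive points it separates; [rev]
    makes the list decreasing. *)
Definition flats f : seq I :=
  rev [seq i : I <- enum I | f (widen_ord (leqnSn _) i) == f (lift ord0 i)].

Lemma flats_sorted f : gt_sorted (flats f).
Proof.
rewrite /gt_sorted map_rev rev_sorted; apply: (subseq_sorted ltn_trans).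
  exact/map_subseq/filter_subseq.
by rewrite val_enum_ord iota_ltn_sorted.
Qed.

Lemma mem_flats f i :
  (i \in flats f) = (f (widen_ord (leqnSn _) i) == f (lift ord0 i)).
Proof. by rewrite mem_rev mem_filter mem_enum andbT. Qed.

(** A jump by two or more would skip the value [(f v).+1], which the interval condition puts in the
    image; by monotonicity a preimage of it fits neither at or before [v] nor at or after [u]. *)
Lemma IO_step f (i : I) :
  f (lift ord0 i) = f (widen_ord (leqnSn _) i) + (i \notin flats f) :> nat.
Proof.
rewrite mem_flats -(inj_eq val_inj) /=.
have /andP[/order_preservingP fo /interval_imageP fi] := IO_funP f.
set u := lift _ _; set v := widen_ord _ _.
have vu : f v <= f u by apply: fo => /=; rewrite /bump /=; lia.
case: eqP => [->|/eqP ne]; rewrite ?addn0 // addn1; apply/eqP.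
rewrite eqn_leq andbC ltn_neqAle ne vu leqNgt; apply/negP => lt.
have ltk : (f v).+1 < k.+2 by apply: ltn_trans lt (ltn_ord (f u)).
have /codomP[w ew] : Ordinal ltk \in codom f.
  by apply: (fi (f v) (Ordinal ltk) (f u) (leqnSn _) (ltnW lt)); apply: codom_f.
move/(congr1 val): ew => /= ew; case: (leqP w i) => wi.
  by have := fo w v wi; lia.
by have := fo u w; rewrite /= /bump /=; lia.
Qed.

Lemma IO_val f (x : X) :
  f x = x - count_lt x (flats f) + f ord0 :> nat.
Proof.
have uD := gt_sorted_uniq (flats_sorted f).
case: x => x xk; elim: x xk => [|x IH] xk /=.
  by rewrite (_ : Ordinal xk = ord0) //; apply: val_inj.
have xk' : x < k.+1 by [].
have -> : Ordinal xk = lift ord0 (Ordinal xk') by apply: val_inj.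
rewrite IO_step (_ : widen_ord _ _ = Ordinal (ltnW xk)); last exact: val_inj.
rewrite IH /= (count_ltS (Ordinal xk') uD) /=.
have := count_lt_leq uD (ltnW xk').
by case: (_ \in _) => /=; lia.
Qed.

(** At the last point [f] takes the value [k.+1 - size (flats f) + f ord0], which is at most
    [k.+1]. *)
Lemma IO0_leq_flats f : f ord0 <= size (flats f).
Proof.
have := IO_val f ord_max; rewrite /= count_lt_size.
have := count_lt_leq (gt_sorted_uniq (flats_sorted f)) (leqnn k.+1).
by rewrite count_lt_size; have := ltn_ord (f ord_max); lia.
Qed.

Lemma nf_flats f : nfIO (flats f) (f ord0) = f.
Proof.
apply/val_inj/ffunP => x; apply: val_inj.
by rewrite /= nf_val ?flats_sorted ?IO0_leq_flats // -IO_val.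
Qed.

Lemma nf0 D s : gt_sorted D -> s <= size D -> nfIO D s ord0 = s :> nat.
Proof. by move=> sD ss; rewrite nf_val. Qed.

Lemma flats_nf D s : gt_sorted D -> s <= size D -> flats (nfIO D s) = D.
Proof.
move=> sD ss; have uD := gt_sorted_uniq sD; apply: (inj_map val_inj).
apply: (irr_sorted_eq _ _ (flats_sorted _) sD).
- by move=> u v w uv wu; apply: ltn_trans wu uv.
- by move=> u /=; rewrite ltnn.
apply: eq_mem_map => i {uD}.
rewrite mem_flats -(inj_eq val_inj) /= !nf_val //= /bump /= add1n.
have uD := gt_sorted_uniq sD; rewrite count_ltS //.
have := count_lt_leq uD (ltnW (ltn_ord i)).
by case: (_ \in _) => /=; lia.
Qed.

End Values.

Lemma class_ofM (C : choiceType) (S : set (seq C * seq C)) u v :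
  class_of S (u ++ v) = (class_of S u * class_of S v)%g.
Proof. exact: class_of_cat. Qed.

(* Innermost conditions first, so that no [if] is left in a hypothesis. *)
Local Ltac case_ifs := repeat match goal with |- context [if ?c then _ else _] =>
  lazymatch c with context [if _ then _ else _] => fail
  | _ => case: (boolP c) => ? end end.

(** * The evaluation homomorphism from the presented monoid *)

Section Evaluation.
Variable n : nat.
Local Notation P := (presented (IO_rels n)).

Definition letter_IO (c : letter n) : IO n :=
  match c with inl i => a_IO i | inr i => b_IO i end.

Definition word_IO (w : seq (letter n)) : IO n :=
  foldr (fun c f => (letter_IO c * f)%g) 1%g w.

Lemma word_IO_cat u v : word_IO (u ++ v) = (word_IO u * word_IO v)%g.
Proof. by elim: u => [|c u IH] /=; rewrite ?mul1g // IH mulgA. Qed.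

Lemma word_IO_rel p : IO_rel p -> word_IO p.1 = word_IO p.2.
Proof.
move=> h; apply/val_inj/ffunP => x; apply: val_inj.
case: h => [i l hl|i j j' ij hj|i l hl|i j i' j' ij hi hj|i j ij|i l hl|i l hl];
  rewrite /= !ffunE /=; have := ltn_ord x; have := ltn_ord i; case_ifs; lia.
Qed.

Lemma word_IO_congr u v : word_congr (IO_rels n) u v -> word_IO u = word_IO v.
Proof.
elim=> {u v} [u v|//|u v _ ->//|u v w _ -> _ ->//|u u' v v' _ eu _ ev].
  by move/word_IO_rel.
by rewrite !word_IO_cat eu ev.
Qed.

Definition eval_IO (x : P) : IO n := word_IO (repr x).

Lemma eval_class_of w : eval_IO (class_of (IO_rels n) w) = word_IO w.
Proof. by apply: word_IO_congr; apply/class_ofP; rewrite class_ofK. Qed.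

Lemma eval_IO_monoid_morphism : monoid_morphism eval_IO.
Proof.
split=> [|x y]; first by rewrite eval_class_of.
by rewrite -[x]class_ofK -[y]class_ofK -class_ofM !eval_class_of word_IO_cat.
Qed.

HB.instance Definition _ :=
  isUMagmaMorphism.Build P (IO n) eval_IO eval_IO_monoid_morphism.

Lemma eval_a i : eval_IO (class_of (IO_rels n) [:: a_ i]) = a_IO i.
Proof. by rewrite eval_class_of /= mulg1. Qed.

Lemma eval_b i : eval_IO (class_of (IO_rels n) [:: b_ i]) = b_IO i.
Proof. by rewrite eval_class_of /= mulg1. Qed.

End Evaluation.

(** * Bijectivity of evaluation *)

Section Reduced.
Local Open Scope group_scope.
Variable k : nat.
Local Notation P := (presented (IO_rels k.+2)).
Let a (i : 'I_k.+1) : P := class_of (IO_rels k.+2) [:: a_ (n := k.+2) i].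
Let b (i : 'I_k.+1) : P := class_of (IO_rels k.+2) [:: b_ (n := k.+2) i].

Lemma presented_reduced (x : P) : reduced a b x.
Proof.
have rel u v : IO_rel (u, v) -> class_of (IO_rels k.+2) u = class_of (IO_rels k.+2) v.
  by move=> uv; apply/class_ofP/word_congr_rel.
have cat u v : class_of (IO_rels k.+2) u * class_of (IO_rels k.+2) v =
    class_of (IO_rels k.+2) (u ++ v) by rewrite class_ofM.
have r1 i : a i * a ord_max = a i by rewrite cat; apply/rel/R1.
have r2 (i j j' : 'I_k.+1) : i <= j -> j' = j.+1 :> nat -> a i * a j = a j' * a i.
  by move=> ij jj; rewrite !cat; apply/rel/R2.
have r4 (i j i' j' : 'I_k.+1) : i <= j -> i' = i.+1 :> nat -> j' = j.+1 :> nat ->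
    b i * b j' = b j' * b i'.
  by move=> ij ii jj; rewrite !cat; apply: rel; apply: (@R4 k.+2 i j).
have r5 (i j : 'I_k.+1) : i < j -> b i * a j = a j * b i.
  by move=> ij; rewrite !cat; apply/rel/R5.
have r6 i : b i * a ord0 = a i by rewrite cat; apply/rel/R6.
have r7 i : a i * b ord_max = b i by rewrite cat; apply/rel/R7.
rewrite -[x]class_ofK; elim: (repr x) => [|[i|i] w IH]; first exact: reduced1.
  by rewrite -cat1s class_ofM; apply: reduced_a.
by rewrite -cat1s class_ofM; apply: reduced_b.
Qed.

(** The inverse sends a map to its normal form. It is a left inverse because every class is some
    [nf D s], and both [D] and [s] can be read off from the map. *)
Lemma eval_IO_bij2 : bijective (@eval_IO k.+2).
Proof.
have evalE D s : eval_IO (nf a (b ord_max) D s) =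
    nf (@a_IO k.+2) (b_IO (ord_max : 'I_(k.+2).-1)) D s.
  rewrite (nf_morph (@eval_IO k.+2)) /= eval_b; congr nf.
  by apply/funext => i /=; rewrite eval_a.
exists (fun f => nf a (b ord_max) (flats f) (f ord0)) => [x|f].
  have [D [s [sD ss ->]]] := presented_reduced x.
  by rewrite evalE nf0 // flats_nf.
by rewrite evalE nf_flats.
Qed.

End Reduced.

Lemma eval_IO_bij n : 0 < n -> bijective (@eval_IO n).
Proof.
case: n => [|[|k]] // _; last exact: eval_IO_bij2.
(* For [n = 1] there are no letters, hence only the empty word, and there is only one map. *)
exists (fun=> 1%g) => [x|f].
  by rewrite -[RHS]class_ofK; case: (repr x) => [|[[]|[]]].
by apply/val_inj/ffunP => i; rewrite [LHS]ord1 [RHS]ord1.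
Qed.

(** * Counting the relations *)

Lemma card_range_inj (T : finType) (U : Type) (f : T -> U) :
  injective f -> (range f #= `I_#|T|)%card.
Proof.
move=> f_inj.
have -> : range f = range (f \o (enum_val : 'I_#|T| -> T)).
  apply/seteqP; split=> _ [t _ <-]; last by exists (enum_val t).
  by exists (enum_rank t) => //=; rewrite enum_rankK.
apply: (card_eq_trans (inj_card_eq _)); last by rewrite card_eq_sym card_II.
by move=> s t _ _ /f_inj /enum_val_inj.
Qed.

Lemma card_ltn_pairs k : #|[set p : 'I_k * 'I_k | p.1 < p.2]| = 'C(k, 2).
Proof.
rewrite -sum1dep_card -(pair_big_dep xpredT (fun i j : 'I_k => i < j) (fun _ _ => 1)) /=.
(* Summing over the larger coordinate [j] first leaves [j] choices for the smaller one. *)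
rewrite (exchange_big_dep xpredT) //= -bin2_sum big_mkord.
apply: eq_bigr => j _; rewrite -(big_ord_widen_cond _ xpredT (fun=> 1)) 1?ltnW //.
by rewrite sum1_card card_ord.
Qed.

Section Count.
Variable k : nat.
Local Notation I := 'I_k.+1.
Local Notation pairs := {p : I * I | p.1 < p.2}.
Local Notation A := (a_ (n := k.+2)).
Local Notation B := (b_ (n := k.+2)).
Local Notation word := (seq (letter k.+2)).

(* The families R1, R3, R6, R7 have one relation per index, the families
   R2, R4, R5 one relation per pair of indices [i < j]. *)
Definition rel_index : Type := (I * 'I_4 + pairs * 'I_3)%type.

(** For R2 and R4 the second entry of the pair is the raised index [j'], so that [i <= j] becomes
    [i < j']; both uses of [inord] are then in range. The default of [nth] is never reached. *)
Definition rel_of (t : rel_index) : word * word :=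
  match t with
  | inl (i, q) => nth ([::], [::])
      [:: ([:: A i; A ord_max], [:: A i]); ([:: B i; B ord0], [:: B i]);
          ([:: B i; A ord0], [:: A i]); ([:: A i; B ord_max], [:: B i])] q
  | inr (p, q) => let: (i, j) := val p in nth ([::], [::])
      [:: ([:: A i; A (inord j.-1)], [:: A j; A i]);
          ([:: B i; B j], [:: B j; B (inord i.+1)]);
          ([:: B i; A j], [:: A j; B i])] q
  end.

(** The seven families have different patterns of a- and b-letters on their two sides, and within a
    family the words display the index or the pair. *)
Lemma rel_of_inj : injective rel_of.
Proof.
case=> [[i [[|[|[|[|?]]]] ?]]|[[[i j] ij] [[|[|[|?]]] ?]]] //;
case=> [[i' [[|[|[|[|?]]]] ?]]|[[[i' j'] ij'] [[|[|[|?]]] ?]]] //= [] *; subst;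
by [congr (inl (_, _)); apply: val_inj|congr (inr (_, _)); apply: val_inj].
Qed.

Lemma range_rel_of : range rel_of = IO_rels k.+2.
Proof.
apply/seteqP; split=> [_ [t _ <-]|uv].
  have pred_j (i j : I) : i < j ->
      [/\ i <= j.-1, j = j.-1.+1 :> nat & j.-1 < k.+1].
    by move=> ij; have := ltn_ord j; split; lia.
  case: t => [[i [[|[|[|[|?]]]] ?]]|[[[i j] /= ij] [[|[|[|?]]] ?]]] //=.
  - exact: R1.
  - exact: R3.
  - exact: R6.
  - exact: R7.
  - by have [ij1 j1 jk] := pred_j i j ij; apply: R2; rewrite inordK.
  - have [ij1 j1 jk] := pred_j i j ij.
    apply: (@R4 k.+2 i (Ordinal jk)) => //=; rewrite inordK //.
    exact: leq_ltn_trans ij (ltn_ord j).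
  - exact: R5.
case=> [i l hl|i j j' ij hj|i l hl|i j i' j' ij hi hj|i j ij|i l hl|i l hl].
- exists (inl (i, inord 0)) => //=; rewrite inordK //=.
  by have -> : l = ord_max by apply: val_inj; case: hl.
- have ij' : i < j' by rewrite hj.
  exists (inr (exist _ (i, j') ij', inord 0)) => //=; rewrite inordK //=.
  by rewrite hj inord_val.
- exists (inl (i, inord 1)) => //=; rewrite inordK //=.
  by have -> : l = ord0 by apply: val_inj.
- have ij' : i < j' by rewrite hj.
  exists (inr (exist _ (i, j') ij', inord 1)) => //=; rewrite inordK //=.
  by rewrite -hi inord_val.
- by exists (inr (exist _ (i, j) ij, inord 2)) => //=; rewrite inordK.
- exists (inl (i, inord 2)) => //=; rewrite inordK //=.
  by have -> : l = ord0 by apply: val_inj.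
- exists (inl (i, inord 3)) => //=; rewrite inordK //=.
  by have -> : l = ord_max by apply: val_inj; case: hl.
Qed.

Lemma card_rel_index : #|{: rel_index}| = k.+1 * 4 + 'C(k.+1, 2) * 3.
Proof.
rewrite card_sum !card_prod !card_ord card_sig -card_ltn_pairs; congr (_ + _ * _).
by apply: eq_card => p; rewrite !inE.
Qed.

End Count.

Lemma card_IO_rels n : 0 < n -> (IO_rels n #= `I_((3 * n ^ 2 - n - 2)./2))%card.
Proof.
case: n => [|[|k]] // _.
  have -> : IO_rels 1 = set0.
    by apply/seteqP; split=> // _ [] [].
  by rewrite (_ : (_./2) = 0) // II0.
have -> : (3 * k.+2 ^ 2 - k.+2 - 2)./2 = #|{: rel_index k}|.
  rewrite card_rel_index bin2 /=; have := bin2 k.+1.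
  (* Evenness of [k.+1 * k] makes the halving in the binomial coefficient exact. *)
  have := odd_double_half (k.+1 * k); rewrite oddM /= andNb add0n; lia.
by rewrite -range_rel_of; apply/card_range_inj/rel_of_inj.
Qed.

Theorem theorem4p8 (n : nat) (hn : 1 <= n) :
  [/\ #|{: letter n}| = 2 * n - 2,
      (IO_rels n #= `I_((3 * n ^ 2 - n - 2)./2))%card
    & exists f : UMagmaMorphism.type (presented (IO_rels n)) (IO n),
        [/\ bijective f,
            forall i : 'I_n.-1, f (class_of (IO_rels n) [:: a_ i]) = a_IO i
          & forall i : 'I_n.-1, f (class_of (IO_rels n) [:: b_ i]) = b_IO i]].
Proof.
split; first by rewrite card_sum !card_ord; lia.
  exact: card_IO_rels.
exists (@eval_IO n); split; first exact: eval_IO_bij.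
- exact: eval_a.
- exact: eval_b.
Qed.
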